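(* Let $L$ be a complex finite dimensional Leibniz algebra, let $I$ be the ideal of $L$ generated by all squares $[x,x]$, $x\in L$, and let $\varphi:L\to L/I$ be the natural homomorphism. Then for every regular element $a$ of $L$, its image $\varphi(a)=a+I$ is a regular element of the Lie algebra $L/I$.
   Context: A Leibniz algebra over a field $F$ is an $F$-vector space $L$ with a bilinear multiplication $[\cdot,\cdot]$ satisfying $[x,[y,z]]=[[x,y],z]-[[x,z],y]$ for all $x,y,z\in L$. For $x\in L$, $R_x:L\to L$ denotes the right multiplication operator $R_x(z)=[z,x]$. Lie algebras are Leibniz algebras, and the quotient of $L$ by the (two-sided) ideal $I=\mathrm{ideal}\langle [x,x] : x\in L\rangle$ is a Lie algebra. For a linear transformation $A$ of a vector space $V$, the Fitting's null-component of $V$ with respect to $A$ is $V_{0A}=\{v\in V : A^i(v)=0 \text{ for some } i\}$. An element $h$ of a finite dimensional Leibniz algebra $L$ is regular if the dimension of the Fitting's null-component $L_{0R_h}$ of $L$ with respect to $R_h$ is minimal (among the dimensions of $L_{0R_x}$, $x\in L$). The same definition is used for the Lie algebra $L/I$. *)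

(* Defs.v *)
From HB Require Import structures.
From mathcomp Require Import all_boot all_order all_algebra.
From mathcomp Require Import generic_quotient ring_quotient.
From mathcomp Require Import boolp classical_sets.
Set Implicit Arguments.
Unset Strict Implicit.
Unset Printing Implicit Defensive.
Import GRing.Theory VectorInternalTheory.
Local Open Scope ring_scope.
Local Open Scope classical_set_scope.
Local Open Scope quotient_scope.

(* Right Leibniz algebras: the right multiplications z |-> [z, x] are
   derivations. *)
HB.mixin Record Vector_isLeibniz (F : fieldType) L of Vector F L := {
  lbr : L -> L -> L;
  lbr_linearl : forall y, linear (lbr^~ y);
  lbr_linearr : forall x, linear (lbr x);
  lbr_leibniz : forall x y z, lbr x (lbr y z) = lbr (lbr x y) z - lbr (lbr x z) y
}.

#[short(type="leibnizType")]
HB.structure Definition Leibniz (F : fieldType) :=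
  { L of Vector_isLeibniz F L & Vector F L }.

Definition is_lie (F : fieldType) (L : leibnizType F) : Prop :=
  forall x : L, lbr x x = 0.

Definition rmul (F : fieldType) (L : leibnizType F) (x : L) : L -> L := lbr^~ x.

HB.instance Definition _ (F : fieldType) (L : leibnizType F) (x : L) :=
  GRing.isLinear.Build F L L _ (rmul x) (lbr_linearl x).
HB.instance Definition _ (F : fieldType) (L : leibnizType F) (x : L) :=
  GRing.isLinear.Build F L L _ (lbr x) (lbr_linearr x).

Section SetVspace.
Variables (F : fieldType) (V : vectType F).

Definition set_submod (S : set V) : Prop :=
  S 0 /\ forall (c : F) u v, S u -> S v -> S (c *: u + v).

(* The {vspace V} with the same elements as S; it is a junk value when S is
   not a linear subspace. *)
Definition set_vspace (S : set V) : {vspace V} :=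
  xget 0%VS [set U : {vspace V} | forall v, v \in U <-> S v].

Lemma set_vspaceP S : set_submod S -> forall v, v \in set_vspace S <-> S v.
Proof.
move=> [S0 SP].
suff exU : exists U : {vspace V}, forall v, v \in U <-> S v.
  by rewrite /set_vspace; apply: (xgetPex 0%VS exU).
have ext n (U : {vspace V}) : (\dim {:V} - \dim U <= n)%N ->
    (forall v, v \in U -> S v) ->
    exists U' : {vspace V}, forall v, v \in U' <-> S v.
  elim: n U => [|n IHn] U dU US.
    exists U => v; split=> [/US //|_].
    have -> : U = fullv.
      by apply/eqP; rewrite eqEdim subvf -subn_eq0 -leqn0.
    exact: memvf.
  case: (pselect (forall v, S v -> v \in U)) => [SU|/existsNP[v /not_implyP[Sv]]].
    by exists U => v; split; [apply: US | apply: SU].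
  move/negP => vU; apply: (IHn (U + <[v]>)%VS).
    have : (\dim U < \dim (U + <[v]>)%VS)%N.
      rewrite ltn_neqAle dimvS ?addvSl // andbT.
      apply: contra vU => /eqP eqd.
      have /eqP -> : U == (U + <[v]>)%VS by rewrite eqEdim addvSl eqd leqnn.
      by rewrite memvE addvSr.
    have := dimvS (subvf (U + <[v]>)%VS).
    move=> le1 lt1; rewrite -ltnS; apply: leq_trans dU.
    by apply: ltn_sub2l => //; apply: leq_trans le1.
  move=> w /memv_addP[u uU [_ /vlineP[c ->] ->]].
  by rewrite addrC; apply: SP => //; apply: US.
apply: (ext (\dim {:V}) 0%VS); first exact: leq_subr.
by move=> v; rewrite memv0 => /eqP ->.
Qed.

End SetVspace.

Section Fitting.
Variables (F : fieldType) (V : vectType F).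

Definition fitting_null (A : {linear V -> V}) : {vspace V} :=
  set_vspace [set v | exists i, iter i A v = 0].

Lemma fitting_nullP (A : {linear V -> V}) v :
  v \in fitting_null A <-> exists i, iter i A v = 0.
Proof.
have iterL i c u w : iter i A (c *: u + w) = c *: iter i A u + iter i A w.
  by elim: i => //= i ->; rewrite linearP.
have iter0 i : iter i A 0 = 0 by elim: i => //= i ->; rewrite linear0.
apply: set_vspaceP; split; first by exists 0%N.
move=> c u w [i ui] [j wj]; exists (i + j)%N.
by rewrite iterL [in X in _ *: X]addnC !iterD ui wj !iter0 scaler0 addr0.
Qed.

End Fitting.

Definition regular (F : fieldType) (L : leibnizType F) (h : L) : Prop :=
  forall x : L, (\dim (fitting_null (rmul h)) <= \dim (fitting_null (rmul x)))%N.

Section Ideals.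
Variables (F : fieldType) (L : leibnizType F).

Definition is_ideal (J : {vspace L}) : Prop :=
  forall x y, x \in J -> lbr x y \in J /\ lbr y x \in J.

Record ideal := Ideal { ideal_vspace :> {vspace L}; idealP : is_ideal ideal_vspace }.

Variable S : set L.

Definition gen_ideal_vspace : {vspace L} :=
  set_vspace [set v | forall J : ideal, (forall s, S s -> s \in J) -> v \in J].

Lemma gen_ideal_vspaceP v :
  v \in gen_ideal_vspace <->
  forall J : ideal, (forall s, S s -> s \in J) -> v \in J.
Proof.
apply: set_vspaceP; split=> [J _|c u w uJ wJ J SJ]; first exact: mem0v.
by rewrite memvD ?memvZ ?uJ ?wJ.
Qed.

Lemma gen_ideal_is_ideal : is_ideal gen_ideal_vspace.
Proof.
move=> x y /gen_ideal_vspaceP xJ.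
by split; apply/gen_ideal_vspaceP => J /xJ /(@idealP J _ y)[].
Qed.

Definition gen_ideal : ideal := Ideal gen_ideal_is_ideal.

Lemma gen_ideal_sub s : S s -> s \in gen_ideal.
Proof. by move=> Ss; apply/gen_ideal_vspaceP => J; apply. Qed.

End Ideals.

Section LeibnizQuotient.
Variables (F : fieldType) (L : leibnizType F) (I : ideal L).

Definition lquot := Quotient.quot (pred_of_vspace I : zmodClosed L).

HB.instance Definition _ := GRing.Zmodule.on lquot.
HB.instance Definition _ := Quotient.on lquot.

(* The natural homomorphism L -> L / I. *)
Definition lproj (x : L) : lquot := \pi_lquot x.

Lemma lproj_repr q : lproj (repr q) = q.
Proof. exact: reprK. Qed.

Lemma lproj_surj q : exists x, lproj x = q.
Proof. by exists (repr q); exact: lproj_repr. Qed.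

Lemma lproj_eq x y : lproj x = lproj y <-> x - y \in I.
Proof.
rewrite (Quotient.idealrBE I x y); split; first by move/eqP.
by move/eqP.
Qed.

Lemma lproj_sub_repr x : repr (lproj x) - x \in I.
Proof. by apply/lproj_eq; rewrite lproj_repr. Qed.

Lemma lprojD x y : lproj (x + y) = lproj x + lproj y.
Proof. exact: (@pi_addr _ _ _ _ _ lquot). Qed.

Definition qscale (c : F) (q : lquot) : lquot := lproj (c *: repr q).

Lemma qscale_lproj c x : qscale c (lproj x) = lproj (c *: x).
Proof. by apply/lproj_eq; rewrite -scalerBr memvZ ?lproj_sub_repr. Qed.

Fact qscaleA c d q : qscale c (qscale d q) = qscale (c * d) q.
Proof. by rewrite -(lproj_repr q) !qscale_lproj scalerA. Qed.
Fact qscale1 : left_id 1 qscale.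
Proof. by move=> q; rewrite -(lproj_repr q) !qscale_lproj scale1r. Qed.
Fact qscaleDr : right_distributive qscale +%R.
Proof.
move=> c p q; rewrite -(lproj_repr p) -(lproj_repr q).
by rewrite -lprojD !qscale_lproj -lprojD scalerDr.
Qed.
Fact qscaleDl q : {morph qscale^~ q : c d / c + d}.
Proof.
by move=> c d; rewrite -(lproj_repr q) !qscale_lproj -lprojD scalerDl.
Qed.

HB.instance Definition _ :=
  GRing.Zmodule_isLmodule.Build F lquot qscaleA qscale1 qscaleDr qscaleDl.

Fact lproj_is_linear : linear lproj.
Proof. by move=> c x y; rewrite lprojD -qscale_lproj. Qed.
HB.instance Definition _ := GRing.isLinear.Build F L lquot _ lproj lproj_is_linear.

(* Finite dimensionality is obtained from a linear complement of I. *)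
Fact lquot_vect_iso : Vector.axiom (\dim (I^C)) lquot.
Proof.
pose f := daddv_pi (I^C)%VS I.
have capI : ((I^C)%VS :&: I)%VS = 0%VS by rewrite capvC capv_compl.
have fI x : (f x == 0) = (x \in I).
  have xE : f x + daddv_pi I (I^C)%VS x = x.
    by apply: daddv_pi_add => //; rewrite addvC addv_complf memvf.
  apply/eqP/idP => [fx0|xI]; first by rewrite -xE fx0 add0r memv_pi.
  have fxI : f x \in ((I^C)%VS :&: I)%VS.
    rewrite memv_cap memv_pi -[f x](addrK (daddv_pi I (I^C)%VS x)) xE.
    by rewrite memvB ?memv_pi.
  by move: fxI; rewrite capI memv0 => /eqP.
have f_eq x y : lproj x = lproj y -> f x = f y.
  by move=> /lproj_eq; rewrite -fI linearB subr_eq0 => /eqP.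
pose g (q : lquot) : 'rV[F]_(\dim (I^C)) := v2r (vsproj (I^C)%VS (f (repr q))).
exists g.
  move=> c p q; rewrite /g (f_eq _ (c *: repr p + repr q)).
    by rewrite !linearP.
  by rewrite linearP /= !lproj_repr.
pose g' (r : 'rV[F]_(\dim (I^C))) := lproj (vsval (@r2v F (subvs_of (I^C)%VS) r)).
exists g' => [q|r].
  rewrite /g' /g v2rK vsprojK ?memv_pi // -[RHS]lproj_repr.
  apply/lproj_eq; rewrite -fI linearB subr_eq0; apply/eqP.
  by rewrite /f /= daddv_pi_proj.
have gE (u : subvs_of (I^C)%VS) : g (lproj (vsval u)) = v2r u.
  by rewrite /g (f_eq _ (vsval u)) ?lproj_repr // /f daddv_pi_id ?subvsP ?vsvalK.
by rewrite /g' gE r2vK.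
Qed.
HB.instance Definition _ := Lmodule_hasFinDim.Build F lquot lquot_vect_iso.

Definition qbr (p q : lquot) : lquot := lproj (lbr (repr p) (repr q)).

Lemma qbr_lproj x y : qbr (lproj x) (lproj y) = lproj (lbr x y).
Proof.
apply/lproj_eq; set x' := repr _; set y' := repr _.
have -> : lbr x' y' - lbr x y = lbr x' (y' - y) + rmul y (x' - x).
  by rewrite !linearB /= /rmul addrA subrK.
by apply: memvD; [have [] := @idealP F L I _ x' (lproj_sub_repr y)
                 | have [] := @idealP F L I _ y (lproj_sub_repr x)].
Qed.

Fact qbr_linearl q : linear (qbr^~ q).
Proof.
move=> c p r; rewrite -(lproj_repr p) -(lproj_repr q) -(lproj_repr r).
by rewrite -lproj_is_linear !qbr_lproj -lproj_is_linear lbr_linearl.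
Qed.
Fact qbr_linearr p : linear (qbr p).
Proof.
move=> c q r; rewrite -(lproj_repr p) -(lproj_repr q) -(lproj_repr r).
by rewrite -lproj_is_linear !qbr_lproj -lproj_is_linear lbr_linearr.
Qed.
Fact qbr_leibniz p q r : qbr p (qbr q r) = qbr (qbr p q) r - qbr (qbr p r) q.
Proof.
rewrite -(lproj_repr p) -(lproj_repr q) -(lproj_repr r) !qbr_lproj.
by rewrite lbr_leibniz linearB.
Qed.
HB.instance Definition _ :=
  Vector_isLeibniz.Build F lquot qbr_linearl qbr_linearr qbr_leibniz.

Lemma lproj_lbr x y : lproj (lbr x y) = lbr (lproj x) (lproj y).
Proof. by rewrite -qbr_lproj. Qed.

End LeibnizQuotient.

Definition square_ideal (F : fieldType) (L : leibnizType F) : ideal L :=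
  gen_ideal [set lbr x x | x in [set: L]].

Lemma lquot_square_is_lie (F : fieldType) (L : leibnizType F) :
  is_lie (lquot (square_ideal L)).
Proof.
move=> q; rewrite -(lproj_repr q) -lproj_lbr.
rewrite -(linear0 (lproj (square_ideal L))); apply/lproj_eq.
by rewrite subr0; apply: gen_ideal_sub; exists (repr q).
Qed.

(* Main.v *)
(** Write [L_0(x)] for the Fitting null-component of [R_x].  The Fitting
    decomposition of [R_x] restricted to [I] gives
    [dim L_0(x) = dim (I :&: L_0(x)) + dim (L/I)_0(phi x)].  Both summands are
    upper semicontinuous in [x]: along a line [a + t (y - a)] each is, for all
    but finitely many [t], at most its value at any prescribed point.  Hence
    some [x] on the line satisfies [dim (I :&: L_0(x)) <= dim (I :&: L_0(a))]
    and [dim (L/I)_0(phi x) <= dim (L/I)_0(phi y)], and regularity of [a]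
    forces [dim (L/I)_0(phi a) <= dim (L/I)_0(phi y)]. *)
Require Import Defs.
From mathcomp Require Import all_boot all_order all_algebra.
From mathcomp Require Import reals complex.
Set Implicit Arguments.
Unset Strict Implicit.
Unset Printing Implicit Defensive.
Import GRing.Theory.
Local Open Scope ring_scope.
Local Open Scope complex_scope.

Lemma rank_lower_semicontinuous (F : fieldType) m n (M : 'M[{poly F}]_(m, n))
    (t0 : F) :
  exists2 p : {poly F}, p.[t0] != 0 &
    forall t, p.[t] != 0 ->
      (\rank (map_mx (horner_eval t0) M) <= \rank (map_mx (horner_eval t) M))%N.
Proof.
set M0 := map_mx _ M.
(* [P] is a left inverse and [Q] a right inverse of the two factors in the full-rank factorization
   of [M0]. *)
pose P := pinvmx (col_base M0); pose Q := pinvmx (row_base M0).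
have PMQ : P *m M0 *m Q = 1%:M.
  rewrite -[in X in _ *m X *m _](mulmx_base M0) mulmxA.
  by rewrite mulVpmx ?col_base_full // mul1mx mulmxVp ?row_base_free.
(* A minor that equals [1] at [t0]: wherever it does not vanish, the rank is
   at least the rank at [t0]. *)
pose p := \det (map_mx polyC P *m M *m map_mx polyC Q).
have polyCK t k l (A : 'M[F]_(k, l)) :
    map_mx (horner_eval t) (map_mx polyC A) = A.
  by apply/matrixP=> i j; rewrite !mxE /horner_eval hornerC.
have pE t : p.[t] = \det (P *m map_mx (horner_eval t) M *m Q).
  by rewrite -/(horner_eval t p) -det_map_mx !map_mxM !polyCK.
exists p; first by rewrite pE PMQ det1 oner_neq0.
move=> t; rewrite pE -unitfE -unitmxE => /mxrank_unit rankr.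
rewrite -[leqLHS]rankr; apply: leq_trans (mxrankM_maxl _ _) _.
exact: mxrankM_maxr.
Qed.

Section Iterates.
Import VectorInternalTheory.
Variables (F : fieldType) (V : vectType F).
Implicit Types (f g : 'End(V)) (U : {vspace V}).

(** Packing the iterate as an endomorphism makes its kernel and its images available as
    subspaces. *)
Definition lpow f i : 'End(V) := iter i (comp_lfun f) \1%VF.

Lemma lpowE f i v : lpow f i v = iter i f v.
Proof. by elim: i => [|i IHi] /=; rewrite ?id_lfunE // comp_lfunE IHi. Qed.

Lemma limg_lpow f i U : (lpow f i @: U)%VS = iter i (lfun_img f) U.
Proof. by elim: i => [|i IHi] /=; rewrite ?lim1g // limg_comp IHi. Qed.

Lemma f2mxDZ f g (t : F) : f2mx (f + t *: g) = f2mx f + t *: f2mx g.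
Proof.
have mulE h r : r *m f2mx h = v2r (h (r2v r)) by rewrite unlock /= !r2vK.
apply/row_matrixP=> j; rewrite !rowE mulmxDr -scalemxAr !mulE.
by rewrite !lfun_simp linearD linearZ.
Qed.

Lemma limg_mx2vs f U : (f @: U)%VS = mx2vs (vs2mx U *m f2mx f).
Proof. by rewrite unlock. Qed.

Lemma dim_limg_lpow f i U :
  \dim (lpow f i @: U) = \rank (iter i (mulmxr (f2mx f)) (vs2mx U)).
Proof.
rewrite limg_lpow; apply/eqmx_rank/eqmxP; elim: i => [|i IHi] /=.
  exact: eqmx_refl.
by rewrite limg_mx2vs; apply: eqmx_trans (mx2vsK _) (eqmxMr _ IHi).
Qed.

(** In coordinates the image is the row space of a matrix with entries polynomial in [t], so its
    dimension is the rank of a specialized polynomial matrix. *)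
Lemma dim_limg_lpow_semicontinuous f g i U (t0 : F) :
  exists2 p : {poly F}, p.[t0] != 0 &
    forall t, p.[t] != 0 ->
      (\dim (lpow (f + t0 *: g) i @: U) <= \dim (lpow (f + t *: g) i @: U))%N.
Proof.
pose A := map_mx polyC (f2mx f) + 'X *: map_mx polyC (f2mx g).
pose M := iter i (mulmxr A) (map_mx polyC (vs2mx U)).
have ME t : \dim (lpow (f + t *: g) i @: U) = \rank (map_mx (horner_eval t) M).
  rewrite dim_limg_lpow {}/M; congr (\rank _).
  elim: i => [|i IHi] /=.
    by apply/matrixP=> j k; rewrite !mxE /horner_eval hornerC.
  rewrite IHi map_mxM /A map_mxD map_mxZ f2mxDZ.
  congr (_ *m (_ + _ *: _)).
  - by apply/matrixP=> j k; rewrite !mxE; apply/esym/hornerC.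
  - exact/esym/hornerX.
  - by apply/matrixP=> j k; rewrite !mxE; apply/esym/hornerC.
have [p p0 pP] := rank_lower_semicontinuous M t0.
by exists p => // t; rewrite !ME; apply: pP.
Qed.

(** Induction on [n]: either [f] is injective on [W], and then [v] is zero, or [f @: W] is a stable
    subspace of smaller dimension containing [f v]. *)
Lemma iter_lfun0_bound f (W : {vspace V}) n v i :
    (\dim W <= n)%N -> (f @: W <= W)%VS -> v \in W ->
  iter i f v = 0 -> iter n f v = 0.
Proof.
elim: n W v i => [|n IHn] W v i.
  by rewrite leqn0 dimv_eq0 => /eqP -> _; rewrite memv0 => /eqP.
move=> dW fW vW; have := limg_ker_dim f W.
have [/eqP kW0 _|kW] := boolP (W :&: lker f == 0)%VS.
  have fW_iter j : iter j f v \in W.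
    by elim: j => // j IHj; apply: (subvP fW); apply: memv_img.
  have iter0 j : iter j f (0 : V) = 0 by elim: j => //= j ->; rewrite linear0.
  suff inj0 j : iter j f v = 0 -> v = 0 by move=> /inj0 ->; rewrite iter0.
  elim: j => //= j IHj fj0; apply: IHj; apply/eqP.
  by rewrite -memv0 -kW0 memv_cap fW_iter memv_ker fj0 eqxx.
rewrite -dimv_eq0 -lt0n in kW.
move=> dimE fi0; rewrite iterSr; apply: (IHn (f @: W)%VS _ i).
- by rewrite -ltnS; apply: leq_trans dW; rewrite -dimE -addn1 addnC leq_add2r.
- exact: limgS.
- exact: memv_img.
- by rewrite -iterSr iterS fi0 linear0.
Qed.

Variable A : {linear V -> V}.
Let f := linfun A.
Let n := \dim {:V}.

Lemma iter_linfun i v : iter i f v = iter i A v.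
Proof. by apply: eq_iter => w; rewrite lfunE. Qed.

(** One exponent, depending only on [\dim {:V}], replaces the existential in [fitting_null]; this
    makes rank-nullity applicable. *)
Lemma fitting_null_lker i : (n <= i)%N -> fitting_null A = lker (lpow f i).
Proof.
move=> le_ni; apply/vspaceP=> v; rewrite memv_ker lpowE.
apply/idP/eqP => [/fitting_nullP[j]|fi0]; last first.
  by apply/fitting_nullP; exists i; rewrite -iter_linfun.
rewrite -iter_linfun; apply: (@iter_lfun0_bound _ fullv) => //.
  exact: subvf.
exact: memvf.
Qed.

Lemma dim_cap_fitting_null U :
  (\dim (U :&: fitting_null A) + \dim (lpow f n @: U))%N = \dim U.
Proof. by rewrite (fitting_null_lker (leqnn n)) limg_ker_dim. Qed.

(** The images of a stable [U] decrease. Both powers have kernel [fitting_null A], so by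
    rank-nullity the two images have equal dimension. *)
Lemma limg_lpow_stable U k :
  (f @: U <= U)%VS -> (lpow f n @: U)%VS = (lpow f (n + k) @: U)%VS.
Proof.
move=> fU; apply/esym/eqP; rewrite eqEdim; apply/andP; split.
  rewrite !limg_lpow iterD -!limg_lpow; apply: limgS; rewrite limg_lpow.
  elim: k => //= k IHk; apply: subv_trans (limgS _ IHk) fU.
have := limg_ker_dim (lpow f (n + k)) U.
rewrite -(fitting_null_lker (leq_addr k n)) -[RHS]dim_cap_fitting_null.
by move/addnI ->.
Qed.

End Iterates.

Section Quotient.
Variables (F : fieldType) (L : leibnizType F).

Lemma dim_cap_fitting_semicontinuous (U : {vspace L}) (a b : L) (t0 : F) :
  exists2 p : {poly F}, p.[t0] != 0 &
    forall t, p.[t] != 0 ->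
      (\dim (U :&: fitting_null (rmul (a + t *: b)%R)) <=
       \dim (U :&: fitting_null (rmul (a + t0 *: b)%R)))%N.
Proof.
have rmulE t :
    linfun (rmul (a + t *: b)) = linfun (rmul a) + t *: linfun (rmul b).
  apply/lfunP=> v; rewrite !lfun_simp addrC [RHS]addrC.
  exact: lbr_linearr.
pose dim_img t := \dim (lpow (linfun (rmul (a + t *: b))) (\dim {:L}) @: U).
have [p p0 pP] := dim_limg_lpow_semicontinuous
  (linfun (rmul a)) (linfun (rmul b)) (\dim {:L}) U t0.
exists p => // t /pP; rewrite -!rmulE => le_img.
(* At [t] and at [t0] alike, the kernel and image dimensions for the same exponent add up to
   [\dim U], so a larger image means a smaller null part. *)
rewrite -(leq_add2r (dim_img t)) dim_cap_fitting_null.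
by rewrite -(dim_cap_fitting_null (rmul (a + t0 *: b)) U) leq_add2l.
Qed.

Variable I : ideal L.

Lemma lproj_iter_rmul i x v :
  lproj I (iter i (rmul x) v) = iter i (rmul (lproj I x)) (lproj I v).
Proof. by elim: i => //= i <-; rewrite /rmul lproj_lbr. Qed.

Lemma lker_lproj : lker (linfun (lproj I)) = I.
Proof.
apply/vspaceP=> v; rewrite memv_ker lfunE /= -(linear0 (lproj I)).
by apply/eqP/idP => [/lproj_eq|vI]; [|apply/lproj_eq]; rewrite subr0.
Qed.

Lemma limg_lproj_fitting_null x :
  (linfun (lproj I) @: fitting_null (rmul x))%VS =
  fitting_null (rmul (lproj I x)).
Proof.
apply/vspaceP=> q; apply/idP/idP.
  move=> /memv_imgP[v /fitting_nullP[i vi0] ->]; apply/fitting_nullP; exists i.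
  by rewrite lfunE /= -lproj_iter_rmul vi0 linear0.
have [v <-] := lproj_surj q => /fitting_nullP[k]; rewrite -lproj_iter_rmul.
rewrite -(linear0 (lproj I)) => /lproj_eq; rewrite subr0 => vkI.
pose f := linfun (rmul x); pose n := \dim {:L}.
have fI : (f @: I <= I)%VS.
  by apply/subvP=> _ /memv_imgP[u uI ->]; rewrite lfunE; case: (idealP x uI).
(* [R_x^(n + k) v] already lies in [R_x^n I = R_x^(n + k) I], so [v] can be
   corrected by an element of [I]. *)
have : iter (n + k) f v \in (lpow f (n + k) @: I)%VS.
  rewrite -limg_lpow_stable // iterD -lpowE memv_img //.
  by rewrite iter_linfun.
move=> /memv_imgP[u uI]; rewrite lpowE => vu.
apply/memv_imgP; exists (v - u).
  apply/fitting_nullP; exists (n + k)%N.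
  by rewrite -iter_linfun -lpowE linearB /= !lpowE vu subrr.
by rewrite lfunE; apply/lproj_eq; rewrite opprB addrC subrK.
Qed.

(** Rank-nullity for the projection restricted to [fitting_null (rmul x)]. *)
Lemma dim_fitting_null_lquot x :
  (\dim (I :&: fitting_null (rmul x)) +
   \dim (fitting_null (rmul (lproj I x))))%N = \dim (fitting_null (rmul x)).
Proof.
by rewrite -limg_lproj_fitting_null capvC -[in LHS]lker_lproj limg_ker_dim.
Qed.

End Quotient.

Lemma regular_lproj (F : closedFieldType) (L : leibnizType F) (I : ideal L)
    (a : L) :
  regular a -> regular (lproj I a).
Proof.
move=> reg_a q; have [y <-] := lproj_surj q.
(* On the line [a + t *: (y - a)], the part in [I] is compared with its value at [a] ([t = 0]), the
   quotient part with its value at the image of [y] ([t = 1]). *)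
have [p p0 pP] := dim_cap_fitting_semicontinuous I a (y - a) 0.
have [r r1 rP] :=
  dim_cap_fitting_semicontinuous fullv (lproj I a) (lproj I (y - a)) 1.
have : p * r != 0.
  by apply: mulf_neq0; [apply: contraNneq p0 | apply: contraNneq r1] => ->;
    rewrite horner0.
(* An algebraically closed field is infinite, so some [t] avoids the roots of both [p] and [r]. *)
move=> /closed_nonrootP[t]; rewrite rootE hornerM mulf_eq0 negb_or.
move=> /andP[/pP + /rP]; rewrite !capfv !scale0r addr0 scale1r.
rewrite -!linearZ -!linearD /= [a + (y - a)]addrC subrK => le_I le_Q.
have := reg_a (a + t *: (y - a)); rewrite -!(dim_fitting_null_lquot I).
move=> le_a; rewrite -(leq_add2l (\dim (I :&: fitting_null (rmul a)))).
by apply: leq_trans le_a _; apply: leq_add.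
Qed.

Theorem proposition3p2 (R : realType) (L : leibnizType R[i]) (a : L) :
  regular a -> regular (lproj (square_ideal L) a).
Proof. exact: regular_lproj. Qed.
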